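(* Let $n=2$ and let the privacy function, viewed as a function of the disclosure strategy $\delta=(\delta_1,\delta_2)$, be $f:[0,1]\times[0,1]\to\mathbb{R}_+$, continuous on the interior of its domain. (i) For any $\mu\in[0,\mu_{\max}]$ and $i=1,2$, the optimal disclosure strategy is $\delta_i^*=\dfrac{\mu}{\mu_{\max}}$. (ii) In the case of the squared Euclidean distance (SED) and the Kullback-Leibler (KL) divergence, the corresponding minimum distance yields the privacy-money functions $$\mathcal{R}_{\mathrm{SED}}(\mu)=2\left(d_i\frac{\mu}{\mu_{\max}}\right)^2\quad\text{(the same value for } i=1,2)$$ and $$\mathcal{R}_{\mathrm{KL}}(\mu)=\sum_{i=1}^2\left(d_i\frac{\mu}{\mu_{\max}}+p_i\right)\log\left(\frac{d_i\,\mu/\mu_{\max}}{p_i}+1\right).$$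
   Context: Let $p=(p_1,p_2)$ and $q=(q_1,q_2)$ be probability distributions with all entries positive and $q_i\neq p_i$ for $i=1,2$; put $d_i=q_i-p_i$. Let $w=(w_1,w_2)$ with $w_i>0$, and $\mu_{\max}=w_1+w_2$. For $\delta=(\delta_1,\delta_2)$ let $t_i=(1-\delta_i)p_i+\delta_i q_i$. For $\mu\in[0,\mu_{\max}]$ the privacy-money function is $$\mathcal{R}(\mu)=\min_\delta f(\delta)\quad\text{subject to}\quad \sum_i w_i\delta_i=\mu,\ \ \sum_i t_i=1,\ \ 0\leqslant\delta_i\leqslant1,$$ where the condition $\sum_i t_i=1$ is equivalent to $\sum_i d_i\delta_i=0$. An optimal disclosure strategy $\delta^*$ is a minimizer of this problem. The SED privacy function is $\sum_i(t_i-p_i)^2$ and the KL privacy function is $\sum_i t_i\log(t_i/p_i)$; $\mathcal{R}_{\mathrm{SED}}$ and $\mathcal{R}_{\mathrm{KL}}$ are the corresponding privacy-money functions. *)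

(* Defs.v *)
From HB Require Import structures.
From mathcomp Require Import all_boot all_order all_algebra.
From mathcomp Require Import all_classical all_reals all_analysis.

Set Implicit Arguments.
Unset Strict Implicit.
Unset Printing Implicit Defensive.

Import Order.TTheory GRing.Theory Num.Theory.
Import numFieldNormedType.Exports.

Local Open Scope classical_set_scope.
Local Open Scope ring_scope.

(* Vectors indexed by {1, ..., n} are row vectors, so that strategies carry
   the product topology of R^n. *)

Definition pos_distribution (R : realType) (n : nat) (p : 'rV[R]_n) : Prop :=
  (forall i, 0 < p 0 i) /\ \sum_i p 0 i = 1.

Definition strategies (R : realType) (n : nat) : set 'rV[R]_n :=
  [set delta : 'rV[R]_n | forall i, 0 <= delta 0 i <= 1].

Definition disclosed (R : realType) (n : nat) (p q delta : 'rV[R]_n) :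
    'rV[R]_n :=
  \row_i ((1 - delta 0 i) * p 0 i + delta 0 i * q 0 i).

Definition mu_max (R : realType) (n : nat) (w : 'rV[R]_n) : R := \sum_i w 0 i.

Definition feasible (R : realType) (n : nat) (p q w : 'rV[R]_n) (mu : R) :
    set 'rV[R]_n :=
  [set delta : 'rV[R]_n | [/\ \sum_i w 0 i * delta 0 i = mu,
                   \sum_i disclosed p q delta 0 i = 1
                 & @strategies R n delta]].

(* A privacy function has domain [0, 1]^n and codomain R_+; it is encoded by a
   total function whose values outside [0, 1]^n are irrelevant. *)
Definition privacy_function (R : realType) (n : nat) (f : 'rV[R]_n -> R) :
    Prop :=
  (forall delta, @strategies R n delta -> 0 <= f delta) /\
  (forall delta, (@strategies R n)° delta -> {for delta, continuous f}).

Definition optimal_strategy (R : realType) (n : nat) (p q w : 'rV[R]_n)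
    (f : 'rV[R]_n -> R) (mu : R) (delta : 'rV[R]_n) : Prop :=
  feasible p q w mu delta /\
  forall delta', feasible p q w mu delta' -> f delta <= f delta'.

Definition is_minimum (R : realType) (A : set R) (m : R) : Prop :=
  A m /\ lbound A m.

(* rho is the privacy-money function of f: on all of [0, mu_max], the minimum
   defining it is attained and equals rho. *)
Definition is_privacy_money (R : realType) (n : nat) (p q w : 'rV[R]_n)
    (f : 'rV[R]_n -> R) (rho : R -> R) : Prop :=
  forall mu, 0 <= mu <= mu_max w ->
    is_minimum (f @` feasible p q w mu) (rho mu).

Definition SED (R : realType) (n : nat) (p q delta : 'rV[R]_n) : R :=
  \sum_i (disclosed p q delta 0 i - p 0 i) ^+ 2.

Definition KL (R : realType) (n : nat) (p q delta : 'rV[R]_n) : R :=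
  \sum_i disclosed p q delta 0 i * ln (disclosed p q delta 0 i / p 0 i).

(* Main.v *)
(* With two symbols, q - p = (d, -d) with d != 0, so the normalisation constraint
   reads d (delta_0 - delta_1) = 0 and forces delta_0 = delta_1; the budget
   constraint then fixes the common value to mu / mu_max. The feasible set is a
   singleton, so every privacy function has the same minimizer. *)

Require Import Defs.
From HB Require Import structures.
From mathcomp Require Import all_boot all_order all_algebra.
From mathcomp Require Import all_classical all_reals all_analysis.
From mathcomp Require Import ring lra.

Set Implicit Arguments.
Unset Strict Implicit.
Unset Printing Implicit Defensive.

Import Order.TTheory GRing.Theory Num.Theory.
Import numFieldNormedType.Exports.

Local Open Scope classical_set_scope.
Local Open Scope ring_scope.

Lemma sum_ord2 (V : nmodType) (F : 'I_2 -> V) :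
  \sum_i F i = F ord0 + F ord_max.
Proof. by rewrite big_ord_recr big_ord1; congr (F _ + _); apply: val_inj. Qed.

Lemma forall_ord2 (P : 'I_2 -> Prop) : P ord0 -> P ord_max -> forall i, P i.
Proof.
move=> P0 P1 [[|[|//]] lti].
- by have -> : Ordinal lti = ord0 by exact: val_inj.
- by have -> : Ordinal lti = ord_max by exact: val_inj.
Qed.

Lemma mu_max2_gt0 (R : realType) (w : 'rV[R]_2) :
  (forall i, 0 < w 0 i) -> 0 < mu_max w.
Proof. by move=> hw; rewrite /mu_max sum_ord2 addr_gt0. Qed.

(** Affine form with slope [q - p]: it turns the normalisation constraint into a linear equation in
    [delta] and exposes the differences appearing in both closed formulas. *)
Lemma disclosedB (R : realType) (n : nat) (p q delta : 'rV[R]_n) (i : 'I_n) :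
  disclosed p q delta 0 i = (q 0 i - p 0 i) * delta 0 i + p 0 i.
Proof. by rewrite mxE; ring. Qed.

Lemma feasible2P (R : realType) (p q w : 'rV[R]_2) (mu : R) (delta : 'rV[R]_2) :
  \sum_i p 0 i = 1 -> \sum_i q 0 i = 1 -> q 0 ord0 != p 0 ord0 ->
  (forall i, 0 < w 0 i) -> 0 <= mu <= mu_max w ->
  feasible p q w mu delta <-> forall i, delta 0 i = mu / mu_max w.
Proof.
move=> sump sumq qp0 hw /andP[mu_ge0 mu_le].
have M_gt0 := mu_max2_gt0 hw; have M_neq0 := lt0r_neq0 M_gt0.
move: sump sumq; rewrite !sum_ord2 => sump sumq.
have d_eq : q 0 ord_max - p 0 ord_max = - (q 0 ord0 - p 0 ord0) by lra.
split=> [[] | deltaE].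
  rewrite !sum_ord2 !disclosedB d_eq => budget normal _.
  have delta_eq : delta 0 ord0 = delta 0 ord_max.
    (* After multiplication by the nonzero difference, the claim is linear in the products occurring
       in [normal]. *)
    apply/(mulfI (_ : q 0 ord0 - p 0 ord0 != 0)); first by rewrite subr_eq0.
    lra.
  have delta0E : delta 0 ord0 = mu / mu_max w.
    (* With equal coordinates, the budget is the common value times [mu_max w]. *)
    apply: (mulIf M_neq0); rewrite divfK // -budget /mu_max sum_ord2 -delta_eq.
    by ring.
  by apply: forall_ord2; rewrite -?delta_eq.
split.
- by rewrite sum_ord2 !deltaE -mulrDl mulrC -sum_ord2 divfK.
- by rewrite sum_ord2 !disclosedB !deltaE d_eq -sump; ring.
(* The range of [mu] is exactly what puts the quotient in [0, 1]. *)
- by move=> i; rewrite deltaE divr_ge0 ?(ltW M_gt0) // ler_pdivrMr // mul1r.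
Qed.

(** When the constant vector is the only feasible point, the set of attained values is a singleton,
    so minimising reduces to evaluating [f] there. *)
Lemma is_privacy_money_unique_feasible (R : realType) (n : nat)
    (p q w : 'rV[R]_n) (f : 'rV[R]_n -> R) (rho : R -> R) :
  (forall mu, 0 <= mu <= mu_max w -> forall delta,
     feasible p q w mu delta <-> forall i, delta 0 i = mu / mu_max w) ->
  (forall mu, f (const_mx (mu / mu_max w)) = rho mu) ->
  is_privacy_money p q w f rho.
Proof.
move=> feasP frho mu hmu; split.
  exists (const_mx (mu / mu_max w)); last exact: frho.
  by apply/(feasP _ hmu) => i; rewrite mxE.
move=> _ [delta /(feasP _ hmu) deltaE <-]; rewrite -frho.
suff -> : delta = const_mx (mu / mu_max w) by [].
by apply/rowP => i; rewrite deltaE mxE.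
Qed.

Theorem theorem7 (R : realType) (p q w : 'rV[R]_2)
    (hp : pos_distribution p) (hq : pos_distribution q)
    (hpq : forall i, q 0 i <> p 0 i) (hw : forall i, 0 < w 0 i) :
  (forall f : 'rV[R]_2 -> R, privacy_function f ->
     forall mu : R, 0 <= mu <= mu_max w ->
     forall delta : 'rV[R]_2,
       optimal_strategy p q w f mu delta <->
       (forall i, delta 0 i = mu / mu_max w))
  /\ (forall i : 'I_2, is_privacy_money p q w (SED p q)
       (fun mu => 2 * ((q 0 i - p 0 i) * (mu / mu_max w)) ^+ 2))
  /\ is_privacy_money p q w (KL p q)
       (fun mu => \sum_(i < 2)
          ((q 0 i - p 0 i) * (mu / mu_max w) + p 0 i)
          * ln ((q 0 i - p 0 i) * (mu / mu_max w) / p 0 i + 1)).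
Proof.
have [p_gt0 sump] := hp; have [_ sumq] := hq.
have feasP mu : 0 <= mu <= mu_max w -> forall delta,
    feasible p q w mu delta <-> forall i, delta 0 i = mu / mu_max w.
  by move=> hmu delta; apply: feasible2P => //; apply/eqP.
split; last split.
- move=> f _ mu hmu delta; split=> [[/(feasP _ hmu)]//|deltaE].
  split=> [|delta' /(feasP _ hmu) delta'E]; first exact/(feasP _ hmu).
  (* Any feasible competitor is the same vector, so the inequality is reflexivity. *)
  suff -> : delta = delta' by [].
  by apply/rowP => i; rewrite deltaE delta'E.
- move=> i; apply: is_privacy_money_unique_feasible => // mu.
  rewrite /SED sum_ord2 !disclosedB !addrK !mxE.
  move: sump sumq; rewrite !sum_ord2 => sump sumq.
  (* Opposite differences have equal squares, so the sum is twice either one, whichever index is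
     chosen. *)
  have d_eq : q 0 ord_max - p 0 ord_max = - (q 0 ord0 - p 0 ord0) by lra.
  by move: i; apply: forall_ord2; rewrite !d_eq; ring.
- apply: is_privacy_money_unique_feasible => // mu.
  apply: eq_bigr => i _; rewrite disclosedB mxE; congr (_ * ln _).
  (* Positivity of [p] allows splitting the ratio inside the logarithm, where [p / p] gives the term
     1. *)
  by rewrite mulrDl divff // lt0r_neq0.
Qed.
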